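(* Suppose the homogeneous polynomial $p\in\mathbb C[y_{ij}]$ is in the ideal generated by $\{y_{mj}:1\le j\le n\}$, i.e. the ideal of polynomial functions on $V^n$ which vanish on $(\ell_0^\perp)^n$. Then $$\theta^*(t,b,R)=\sum_{X\in h+L^n}\Big|p\big(a(t)^{-1}n(b)^{-1}X\big)\exp\big(-\pi R(a(t)^{-1}n(b)^{-1}X)\big)\Big|$$ is exponentially decreasing (as $t\to\infty$) on the Siegel set $\mathfrak S'$.
   Context: $V$ is a $\mathbb Q$-vector space of dimension $m=p_0+1$ with a non-degenerate symmetric bilinear form of signature $(p_0,1)$; $u_0,u_0'\in V$ are isotropic with $(u_0,u_0')=-\frac12$, $\ell_0=\mathbb Qu_0$, $\ell_0'=\mathbb Qu_0'$, $W=\{u_0,u_0'\}^\perp$. $L\subset V$ is a $\mathbb Z$-lattice with $L\subset L^{\#}$, assumed to be of the form $L=(L\cap\ell_0)+(L\cap W)+(L\cap\ell_0')$; $1\le n\le p_0$, $h\in(L^{\#})^n$. Fix a basis $w_1,\dots,w_{m-2}$ of $W$; $y_{ij}$ ($1\le i\le m$, $1\le j\le n$) are the coordinates of $X=(x_1,\dots,x_n)\in V(\mathbb R)^n$ with respect to the basis $u_0,w_1,\dots,w_{m-2},u_0'$ ($y_{mj}$ being the $u_0'$-coordinate of $x_j$). $a(t)$, $t>0$, is the isometry $u_0\mapsto tu_0$, $u_0'\mapsto t^{-1}u_0'$, identity on $W$; $n(b)$, $b\in W(\mathbb R)$, is the isometry $u_0\mapsto u_0$, $x\mapsto x+2(x,b)u_0$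 for $x\in W$, $u_0'\mapsto u_0'+b+(b,b)u_0$. $R$ is a complex-valued quadratic function on $V(\mathbb R)^n$ with positive definite real part. $\mathfrak S'$ is the set of $n(b)a(t)(u_0+u_0')$ with $b$ in a fixed relatively compact open set and $t>t_0$ for a fixed $t_0>0$; exponentially decreasing on it means bounded by $C_1e^{-C_2t}$ for some constants $C_1,C_2>0$. *)

(* Defs.v *)
From HB Require Import structures.
From mathcomp Require Import all_boot all_order all_algebra.
From mathcomp Require Import sesquilinear complex.
From mathcomp Require mpoly.
From mathcomp Require Import all_classical all_reals all_analysis.

Set Implicit Arguments.
Unset Strict Implicit.
Unset Printing Implicit Defensive.

Import Order.TTheory GRing.Theory Num.Theory.
Import -(notations) mpoly.
Import numFieldNormedType.Exports.

Local Open Scope classical_set_scope.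
Local Open Scope ring_scope.
Local Open Scope complex_scope.

Section RationalSide.
Variables (V : vectType rat) (B : {symmetric V}).

(* An orthogonal basis with p positive and q negative squares; by Sylvester's
   law of inertia (p, q) depends only on B. *)
Definition has_signature (p q : nat) :=
  exists e : (p + q).-tuple V,
    [/\ basis_of fullv e,
        forall i j : 'I_(p + q), i != j -> B e`_i e`_j = 0,
        forall i : 'I_(p + q), (i < p)%N -> 0 < B e`_i e`_i
      & forall i : 'I_(p + q), (p <= i)%N -> B e`_i e`_i < 0].

Definition is_lattice (L : set V) :=
  exists e : (\dim {:V}).-tuple V,
    basis_of fullv e /\ L = [set x | inIntSpan e x].

Definition dual_lattice (L : set V) : set V :=
  [set x | forall y, L y -> B x y \is a Num.int].

Definition split_lattice (L : set V) (l W l' : {vspace V}) :=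
  L = [set x | exists a b c : V,
         [/\ L a /\ a \in l, L b /\ b \in W, L c /\ c \in l' & x = a + b + c]].

(* h + L^n *)
Definition coset (n : nat) (L : set V) (h : 'I_n -> V) : set {ffun 'I_n -> V} :=
  [set X | forall j, L (X j - h j)].

End RationalSide.

Definition expC (K : realType) (z : K[i]) : K[i] :=
  (expR (complex.Re z))%:C * (cos (complex.Im z) +i* sin (complex.Im z)).

(* V(K) is modelled by column vectors of coordinates with respect to the basis
   u0, w_1, ..., w_k, u0' of V, so that V(K)^n is the space of matrices (y_ij)
   whose j-th column is x_j; the last row consists of the u0'-coordinates.
   W(K) is modelled by coordinates with respect to w. *)
Section RealPoints.
Variables (K : realType) (V : vectType rat) (B : {symmetric V}).
Variables (k : nat) (u0 u0' : V) (w : k.-tuple V).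

Local Notation m := (1 + (k + 1))%N.

Definition adapted_basis : m.-tuple V :=
  cat_tuple [tuple u0] (cat_tuple w [tuple u0']).

Definition realpts (n : nat) (X : {ffun 'I_n -> V}) : 'M[K]_(m, n) :=
  \matrix_(i, j) ratr (coord adapted_basis i (X j)).

Definition formK (x y : 'cV[K]_m) : K :=
  (x^T *m (\matrix_(i, j) ratr (B adapted_basis`_i adapted_basis`_j)) *m y) 0 0.

Definition u0K : 'cV[K]_m := delta_mx ord0 0.
Definition u0'K : 'cV[K]_m := delta_mx ord_max 0.

(* The matrix of the inclusion of W(K) in V(K); its columns are the w_i. *)
Definition inclW : 'M[K]_(m, k) := col_mx 0 (col_mx 1%:M 0).

(* The columns of the next two matrices are the images of u0, the w_i, u0'. *)
Definition isom_a (t : K) : 'M[K]_m :=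
  row_mx (t *: u0K) (row_mx inclW (t^-1 *: u0'K)).

Definition isom_n (b : 'cV[K]_k) : 'M[K]_m :=
  let bV := inclW *m b in
  row_mx u0K
    (row_mx (inclW + u0K *m \row_i (2 * formK (col i inclW) bV))
            (u0'K + bV + formK bV bV *: u0K)).

Definition siegel_pt (t : K) (b : 'cV[K]_k) : 'cV[K]_m :=
  isom_n b *m isom_a t *m (u0K + u0'K).

Definition siegel_set (omega : set 'cV[K]_k) (t0 : K) : set 'cV[K]_m :=
  [set z | exists t b, [/\ omega b, t0 < t & z = siegel_pt t b]].

(* f is a function on the space of points siegel_pt t b, t > 0, written in the
   parameters t and b. *)
Definition exp_decreasing_on (S : set 'cV[K]_m)
    (f : K -> 'cV[K]_k -> \bar K) :=
  exists C1 C2 : K, [/\ 0 < C1, 0 < C2 &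
    forall t b, 0 < t -> S (siegel_pt t b) ->
      (f t b <= (C1 * expR (- (C2 * t)))%:E)%E].

Section Theta.
Variable n : nat.

(* C[y_ij], the variable y_ij having index mxvec_index i j. *)
Definition ypoly := mpoly (m * n) K[i].

Definition yvar (i : 'I_m) (j : 'I_n) : ypoly :=
  mpolyX K[i] (mnm1 (mxvec_index i j)).

Definition yeval (p : ypoly) (X : 'M[K]_(m, n)) : K[i] :=
  meval (fun l => (mxvec X 0 l)%:C) p.

Definition homogeneous (p : ypoly) :=
  exists d : nat, p \is ishomog1 d mdeg.

Definition in_last_row_ideal (p : ypoly) :=
  exists q : 'I_n -> ypoly, p = \sum_j q j * yvar ord_max j.

Definition quadratic (Q : 'M[K]_(m, n) -> K[i]) :=
  exists c : 'I_m -> 'I_n -> 'I_m -> 'I_n -> K[i], forall X,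
    Q X = \sum_i \sum_j \sum_i' \sum_j' c i j i' j' * (X i j * X i' j')%:C.

Definition posdef_re (Q : 'M[K]_(m, n) -> K[i]) :=
  forall X, X != 0 -> 0 < complex.Re (Q X).

(* esum is the supremum of the finite partial sums, +oo if the series of
   nonnegative terms diverges. *)
Definition theta_star (L : set V) (h : 'I_n -> V) (p : ypoly)
    (Q : 'M[K]_(m, n) -> K[i]) (t : K) (b : 'cV[K]_k) : \bar K :=
  \esum_(X in coset L h)
    let Y := invmx (isom_a t) *m (invmx (isom_n b) *m realpts X) in
    (Normc.normc (yeval p Y * expC (- (pi%:C * Q Y))))%:E.

End Theta.
End RealPoints.

(* Main.v *)
(* Put Y = a(t)^-1 n(b)^-1 X, so that X = n(b) a(t) Y. On the Siegel set the
   entries of n(b) a(t) are O(t), hence |X| <= c t |Y|, while the last row of Y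
   is t times that of X. As p lies in the ideal of the last row, only those X
   with nonzero last row contribute; the coordinates of X lie in (1/D)Z, so
   |Y| >= t/D. Multiplying the two bounds, |Y|^2 >= |X|/(c D). Since
   |p(Y) exp(-pi R(Y))| <= C exp(-a |Y|^2), each term is at most
   C exp(-c1 t^2) exp(-c2 |X|), and the sum of exp(-c2 |X|) over the coset is a
   finite constant independent of t and b. *)
Require Import Defs.
From HB Require Import structures.
From mathcomp Require Import all_boot all_order all_algebra.
From mathcomp Require Import sesquilinear complex.
From mathcomp Require mpoly.
From mathcomp Require Import all_classical all_reals all_analysis.
From mathcomp Require Import ring.

Set Implicit Arguments.
Unset Strict Implicit.
Unset Printing Implicit Defensive.

Import Order.TTheory GRing.Theory Num.Theory.
Import -(notations) mpoly.
Import numFieldNormedType.Exports.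

Local Open Scope classical_set_scope.
Local Open Scope ring_scope.

Section Growth.
Variable K : realType.

Lemma normc_expC (z : K[i]%C) : Normc.normc (expC z) = expR (complex.Re z).
Proof.
rewrite /expC Normc.normcM /= cos2Dsin2 sqrtr1 mulr1.
by rewrite expr0n addr0 sqrtr_sqr ger0_norm // expR_ge0.
Qed.

Lemma mx_entry_le_norm m n (A : 'M[K]_(m, n)) i j : `|A i j| <= `|A|.
Proof.
rewrite {2}/Num.norm /= mx_normrE.
exact: (le_bigmax 0 (fun ij : 'I_m * 'I_n => `|A ij.1 ij.2|) (i, j)).
Qed.

Lemma mx_norm_le m n (A : 'M[K]_(m, n)) c :
  0 <= c -> (forall i j, `|A i j| <= c) -> `|A| <= c.
Proof.
move=> c0 Ac; rewrite {1}/Num.norm /= mx_normrE.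
by apply/bigmax_leP; split => // ij _; exact: Ac.
Qed.

Lemma mulmx_norm_le m n l (A : 'M[K]_(m, n)) (B : 'M[K]_(n, l)) :
  `|A *m B| <= n%:R * (`|A| * `|B|).
Proof.
apply: mx_norm_le => [|i j]; first by rewrite !mulr_ge0.
rewrite mxE (le_trans (ler_norm_sum _ _ _))//.
rewrite -[X in X%:R]card_ord mulr_natl -sumr_const ler_sum // => s _.
by rewrite normrM ler_pM // mx_entry_le_norm.
Qed.

Lemma scalar_mx_norm_le n (a : K) : `|a%:M : 'M[K]_n| <= `|a|.
Proof.
apply: mx_norm_le => // i j; rewrite mxE.
by case: (i == j); rewrite ?mulr1n ?mulr0n ?normr0.
Qed.

Lemma row_mx_norm_le m n1 n2 (A : 'M[K]_(m, n1)) (B : 'M[K]_(m, n2)) :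
  `|row_mx A B| <= `|A| + `|B|.
Proof.
apply: mx_norm_le => [|i j]; first by rewrite addr_ge0.
rewrite mxE; case: splitP => j' _.
  by rewrite (le_trans (mx_entry_le_norm A i j')) // lerDl.
by rewrite (le_trans (mx_entry_le_norm B i j')) // lerDr.
Qed.

Lemma block_mx_norm_le m1 m2 n1 n2 (A : 'M[K]_(m1, n1)) (B : 'M[K]_(m1, n2))
    (C : 'M[K]_(m2, n1)) (D : 'M[K]_(m2, n2)) :
  `|block_mx A B C D| <= `|A| + `|B| + `|C| + `|D|.
Proof.
apply: mx_norm_le => [|i j]; first by rewrite !addr_ge0.
rewrite !mxE; case: splitP => i' _; rewrite !mxE; case: splitP => j' _.
- by rewrite -!addrA (le_trans (mx_entry_le_norm A i' j')) // lerDl !addr_ge0.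
- rewrite (le_trans (mx_entry_le_norm B i' j')) // addrAC [`|A| + _]addrC.
  by rewrite -!addrA lerDl !addr_ge0.
- rewrite (le_trans (mx_entry_le_norm C i' j')) // addrAC lerDr.
  by rewrite !addr_ge0.
- by rewrite (le_trans (mx_entry_le_norm D i' j')) // lerDr !addr_ge0.
Qed.

Lemma expR_sqr_norm_dominates (eps x : K) : 0 < eps ->
  `|x| <= eps^-1 * expR (eps * x ^+ 2) + 1.
Proof.
move=> e0; have [x1|x1] := leP `|x| 1.
  by rewrite (le_trans x1) // lerDr mulr_ge0 ?expR_ge0 ?invr_ge0 ?ltW.
have le1 : eps * x ^+ 2 <= expR (eps * x ^+ 2).
  by rewrite (le_trans _ (expR_ge1Dx _))// lerDr.
have : x ^+ 2 <= eps^-1 * expR (eps * x ^+ 2).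
  by rewrite ler_pdivlMl.
rewrite -(real_normK (num_real x)) => h.
rewrite (le_trans _ (le_trans h _)) ?lerDl //.
by rewrite expr2 ler_peMr // ltW.
Qed.

Lemma poly_growth m n (q : ypoly K m n) (eps : K) : 0 < eps ->
  exists2 C, 0 < C &
    forall X, Normc.normc (yeval q X) <= C * expR (eps * `|X| ^+ 2).
Proof.
pose P (q : ypoly K m n) := forall eps, 0 < eps -> exists2 C, 0 < C &
    forall X, Normc.normc (yeval q X) <= C * expR (eps * `|X| ^+ 2).
have normc_ge0 (z : K[i]%C) : 0 <= Normc.normc z.
  by case: z => a b; exact: sqrtr_ge0.
have exp_ge1 (e x : K) : 0 < e -> 1 <= expR (e * x ^+ 2).
  by move=> e0; rewrite -expR0 ler_expR mulr_ge0 ?sqr_ge0 ?ltW.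
have PD q1 q2 : P q1 -> P q2 -> P (q1 + q2).
  move=> P1 P2 e e0; have [C1 C1_gt0 h1] := P1 _ e0.
  have [C2 C2_gt0 h2] := P2 _ e0.
  exists (C1 + C2) => [|X]; first by rewrite addr_gt0.
  rewrite /yeval mevalD (le_trans (le_normcD _ _))//.
  by rewrite mulrDl lerD ?h1 ?h2.
have PM q1 q2 : P q1 -> P q2 -> P (q1 * q2).
  move=> P1 P2 e e0; have e2 : 0 < e / 2 by rewrite divr_gt0.
  have [C1 C1_gt0 h1] := P1 _ e2; have [C2 C2_gt0 h2] := P2 _ e2.
  exists (C1 * C2) => [|X]; first by rewrite mulr_gt0.
  rewrite /yeval mevalM Normc.normcM [X in expR (X * _)](splitr e) mulrDl expRD.
  by rewrite mulrACA ler_pM ?normc_ge0 ?h1 ?h2.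
have PC c : P (mpolyC _ c).
  move=> e e0; exists (Normc.normc c + 1) => [|X].
    by rewrite ltr_wpDl ?normc_ge0.
  rewrite /yeval mevalC (@le_trans _ _ (Normc.normc c + 1)) ?lerDl//.
  by rewrite ler_peMr ?exp_ge1 // addr_ge0 ?normc_ge0.
have PX l : P (mpolyX _ (mnm1 l)).
  move=> e e0; exists (e^-1 + 1) => [|X].
    by rewrite addr_gt0 // invr_gt0.
  rewrite /yeval mevalXU /=; case/mxvec_indexP: l => i j.
  rewrite mxvecE expr0n addr0 sqrtr_sqr.
  rewrite (le_trans (mx_entry_le_norm _ _ _))//.
  rewrite -[X in X <= _](normr_id X).
  rewrite (le_trans (expR_sqr_norm_dominates _ e0)) // mulrDl mul1r lerD2l.
  exact: exp_ge1.
suff : P q by exact.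
elim/mpolyind: q => [|c mon q _ _ Pq].
  by rewrite -[0]mpolyC0; exact: PC.
apply: PD => //; rewrite -mul_mpolyC; apply: (PM) => //.
have P1 : P 1 by rewrite -mpolyC1; exact: PC.
rewrite mpolyXE_id; apply: (big_ind P P1 PM) => l _.
by elim: (mon l) => [|s IHs]; rewrite ?expr0 // exprS; exact: PM.
Qed.

Lemma last_row_ideal_vanish k n (p : ypoly K k n)
    (X : 'M[K]_((1 + (k + 1))%N, n)) :
  in_last_row_ideal p -> (forall j, X ord_max j = 0) -> yeval p X = 0.
Proof.
move=> [q ->] X0; rewrite /yeval (big_morph _ (mevalD _) (meval0 _)).
rewrite big1 // => j _.
by rewrite mevalM mevalXU mxvecE X0 mulr0.
Qed.

Lemma posdef_re_lower_bound k n (Q : 'M[K]_((1 + (k + 1))%N, n) -> K[i]%C) :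
  quadratic Q -> posdef_re Q ->
  exists2 c, 0 < c & forall X, c * `|X| ^+ 2 <= complex.Re (Q X).
Proof.
move=> [c Qc] Qpos.
pose f (X : 'M[K]_((1 + (k + 1))%N, n)) := \sum_i \sum_j \sum_i' \sum_j'
   complex.Re (c i j i' j') * (X i j * X i' j').
have ReD (x y : K[i]%C) : complex.Re (x + y) = complex.Re x + complex.Re y.
  by case: x => ? ?; case: y.
have Re_sum (I : finType) (F : I -> K[i]%C) :
  complex.Re (\sum_i F i) = \sum_i complex.Re (F i).
  exact: (big_morph _ ReD).
have Qf X : complex.Re (Q X) = f X.
  rewrite Qc Re_sum; apply: eq_bigr => i _; rewrite Re_sum.
  apply: eq_bigr => j _; rewrite Re_sum; apply: eq_bigr => i' _.
  rewrite Re_sum; apply: eq_bigr => j' _.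
  by case: (c i j i' j') => a b /=; rewrite mulr0 subr0.
have fZ a X : f (a *: X) = a ^+ 2 * f X.
  rewrite /f mulr_sumr; apply: eq_bigr => i _; rewrite mulr_sumr.
  apply: eq_bigr => j _; rewrite mulr_sumr; apply: eq_bigr => i' _.
  by rewrite mulr_sumr; apply: eq_bigr => j' _; rewrite !mxE; ring.
have f0 : f 0 = 0 by rewrite -(scale0r 0) fZ expr0n mul0r.
have fcont : continuous (f \o vec_mx).
  have cont_sum (I : finType) (F : I -> 'rV[K]_((1 + (k + 1)) * n) -> K) :
    (forall i, continuous (F i)) -> continuous (fun v => \sum_i F i v).
    move=> Fc; apply: continuous_big => [|i _]; last exact: Fc.
    exact: add_continuous.
  do 4 apply: (cont_sum) => ?.
  have vec_mx_coord i j : continuous (fun v : 'rV[K]_((1 + (k + 1)) * n) =>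
      vec_mx v i j : K).
    rewrite (_ : (fun v => _) = (fun v : 'rV[K]_((1 + (k + 1)) * n) =>
      v 0 (mxvec_index i j))); last first.
      by apply/funext => v; rewrite -[in RHS](vec_mxK v) mxvecE.
    exact: coord_continuous.
  have contM (g h : 'rV[K]_((1 + (k + 1)) * n) -> K) : continuous g ->
      continuous h -> continuous (fun v => g v * h v).
    by move=> gc hc v; exact: continuousM (gc v) (hc v).
  apply: (contM (fun=> _)); first by move=> v; exact: cst_continuous.
  by apply: contM; exact: vec_mx_coord.
pose S : set 'rV[K]_((1 + (k + 1)) * n) := [set v | `|v| = 1].
have [S0|/set0P S_neq0] := eqVneq S set0.
  exists 1 => // X; have [->|X0] := eqVneq X 0.
    by rewrite normr0 expr0n mulr0 Qf f0.
  have : S (`|mxvec X|^-1 *: mxvec X).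
    by rewrite /S /= normfZV // mxvec_eq0.
  by rewrite S0.
have S_compact : compact S.
  apply: bounded_closed_compact.
    exists 1; split => // M M1 v /= ->; exact: ltW.
  have -> : S = Num.norm @^-1` [set 1] by [].
  apply: preimage_closed => [v _|]; last exact: closed_eq.
  exact: norm_continuous.
have [v vS vmin] := compact_EVT_min S_neq0 S_compact
  (continuous_subspaceT fcont).
have norm_vec X : `|mxvec X : 'rV[K]_((1 + (k + 1)) * n)| = `|X|.
  apply/eqP; rewrite eq_le; apply/andP; split; apply: mx_norm_le => // i j.
    by rewrite ord1; case/mxvec_indexP: j => *; rewrite mxvecE mx_entry_le_norm.
  by rewrite -mxvecE mx_entry_le_norm.
exists (f (vec_mx v)) => [|X].
  rewrite -Qf; apply: Qpos; rewrite vec_mx_eq0 -normr_eq0.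
  by move: vS; rewrite inE /S /= => ->; rewrite oner_eq0.
have [->|X0] := eqVneq X 0.
  by rewrite normr0 expr0n mulr0 Qf f0.
have nX0 : `|X| != 0 by rewrite normr_eq0.
have XS : `|X|^-1 *: mxvec X \in S.
  by rewrite inE /S /= -norm_vec normfZV // mxvec_eq0.
have := vmin _ XS; rewrite /= linearZ /= mxvecK fZ => h.
rewrite Qf -ler_pdivlMr ?exprn_gt0 ?normr_gt0 //.
by rewrite (le_trans h) // exprVn mulrC.
Qed.

End Growth.

Section Counting.
Variable K : realType.

Lemma sum_geometric_le (r : K) n : 0 <= r < 1 ->
  \sum_(i < n) r ^+ i <= (1 - r)^-1.
Proof.
move=> /andP[r0 r1]; rewrite -[leRHS]mul1r ler_pdivlMr ?subr_gt0 //.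
rewrite mulrC -opprB mulNr -subrX1 opprB.
by rewrite lerBlDr lerDl exprn_ge0.
Qed.

Lemma sum_geometric_family_le (T : choiceType) (I : finType) (s : seq T)
    (g : T -> I -> nat) (r : K) : 0 <= r < 1 -> uniq s ->
  {in s &, forall x y, g x =1 g y -> x = y} ->
  \sum_(x <- s) \prod_i r ^+ g x i <= (1 - r)^-1 ^+ #|I|.
Proof.
move=> r01 us inj_g; have /andP[r0 r1] := r01.
pose M := (\max_(x <- s) \max_i g x i).+1.
have gM x i : x \in s -> (g x i < M)%N.
  move=> xs; rewrite ltnS (leq_trans (leq_bigmax i)) //.
  exact: (@leq_bigmax_seq _ s xpredT (fun x => \max_i g x i) x).
pose G x : {ffun I -> 'I_M} := [ffun i => inord (g x i)].
have GE x i : x \in s -> G x i = g x i :> nat.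
  by move=> xs; rewrite ffunE inordK ?gM.
have -> : \sum_(x <- s) \prod_i r ^+ g x i =
          \sum_(f <- map G s) \prod_i r ^+ f i.
  rewrite big_map !big_seq; apply: eq_bigr => x xs.
  by apply: eq_bigr => i _; rewrite GE.
have uGs : uniq (map G s).
  rewrite map_inj_in_uniq // => x y xs ys Gxy; apply: inj_g => // i.
  by rewrite -GE // Gxy GE.
rewrite big_uniq //=.
rewrite (@le_trans _ _ (\sum_(f : {ffun I -> 'I_M}) \prod_i r ^+ f i)) //.
  rewrite [leRHS](bigID (mem (map G s))) /= lerDl sumr_ge0 // => f _.
  by rewrite prodr_ge0 // => i _; rewrite exprn_ge0.
rewrite -(bigA_distr_bigA (fun i (j : 'I_M) => r ^+ j)) prodr_const.
rewrite lerXn2r ?nnegrE ?sum_geometric_le //.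
  by rewrite sumr_ge0 // => i _; rewrite exprn_ge0.
by rewrite invr_ge0 subr_ge0 ltW.
Qed.

Lemma esum_geometric_le (T : choiceType) (I : finType) (A : set T) (f : T -> K)
    (g : T -> I -> nat) (C r : K) : 0 <= C -> 0 <= r < 1 ->
  (forall x y, A x -> A y -> g x =1 g y -> x = y) ->
  (forall x, A x -> f x <= C * \prod_i r ^+ g x i) ->
  (\esum_(x in A) (f x)%:E <= (C * (1 - r)^-1 ^+ #|I|)%:E)%E.
Proof.
move=> C0 r01 inj_g fg; apply: ge_ereal_sup => _ [F [finF FA] <-].
rewrite fsbig_finite // sumEFin lee_fin.
rewrite (@le_trans _ _ (C * \sum_(x <- finmap.enum_fset (fset_set F))
  \prod_i r ^+ g x i)) //.
  rewrite mulr_sumr !big_seq ler_sum // => x; rewrite in_fset_set // inE => Fx.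
  exact/fg/FA.
rewrite ler_wpM2l // sum_geometric_family_le // => x y.
by rewrite !in_fset_set // !inE => Fx Fy; apply: inj_g; exact: FA.
Qed.

End Counting.

Section Rational.

Lemma common_denominator (s : seq rat) :
  exists2 D : nat, (0 < D)%N & {in s, forall x, D%:R * x \is a Num.int}.
Proof.
elim: s => [|x s [D D_gt0 intD]]; first by exists 1%N.
exists (`|denq x| * D)%N => [|y].
  by rewrite muln_gt0 D_gt0 absz_gt0 denq_neq0.
rewrite inE natrM => /predU1P[->|ys]; last first.
  by rewrite -mulrA rpredM ?natr_int ?intD.
rewrite mulrAC rpredM ?natr_int // mulrC.
rewrite (_ : _%:R = (denq x)%:~R) -?numqE ?intr_int //.
by rewrite -[in RHS](gez0_abs (denq_ge0 x)) pmulrn.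
Qed.

Lemma coset_common_denominator (V : vectType rat) n m (L : set V)
    (h : 'I_n -> V) (b : m.-tuple V) : is_lattice L ->
  exists2 D : nat, (0 < D)%N & forall X, coset L h X ->
    forall i j, D%:R * coord b i (X j) \is a Num.int.
Proof.
move=> [e [_ ->]].
have [D D_gt0 intD] := common_denominator
  ([seq coord b i e`_k | i : 'I_m <- enum 'I_m,
                         k : 'I_(\dim {:V}) <- enum 'I_(\dim {:V})] ++
   [seq coord b i (h j) | i : 'I_m <- enum 'I_m, j : 'I_n <- enum 'I_n]).
exists D => // X /= coX i j; have [a Xa] := coX j.
have -> : coord b i (X j) =
    \sum_(k < \dim {:V}) coord b i e`_k *~ a k + coord b i (h j).
  rewrite -[X j](subrK (h j)) Xa linearD /= linear_sum /=.
  by congr (_ + _); apply: eq_bigr => k _; rewrite raddfMz.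
rewrite mulrDr mulr_sumr rpredD ?rpred_sum // => [k _|].
  rewrite mulrzAr rpredMz // intD // mem_cat; apply/orP; left.
  by apply: allpairs_f; rewrite mem_enum.
rewrite intD // mem_cat; apply/orP; right.
by apply: allpairs_f; rewrite mem_enum.
Qed.

Lemma adapted_basisP (V : vectType rat) (B : {symmetric V}) k (u0 u0' : V)
    (w : k.-tuple V) :
  \dim {:V} = k.+2 ->
  B u0 u0 = 0 -> B u0' u0' = 0 -> B u0 u0' != 0 ->
  basis_of (orthov B <<[:: u0; u0']>>) w ->
  basis_of fullv (adapted_basis u0 u0' w).
Proof.
move=> dimV B00 B11 B01 wb.
have w_orth x v : x \in w -> v \in [:: u0; u0'] -> B x v = 0.
  move=> xw vu; have : x \in orthov B <<[:: u0; u0']>>.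
    by rewrite -(span_basis wb) memv_span.
  by move/mem_orthovP; apply; exact: memv_span.
have notin_span x v (Z : seq V) : B x v != 0 -> {in Z, forall z, B z v = 0} ->
    x \notin <<Z>>%VS.
  move=> Bxv BZ; apply: contra Bxv => xZ; rewrite -mem_orthov1.
  have /subvP : (<<Z>> <= orthov B <[v]>)%VS.
    by apply/span_subvP => z /BZ; rewrite mem_orthov1 => ->.
  exact.
have sizeb : (k.+2 <= size (adapted_basis u0 u0' w))%N.
  by rewrite size_tuple add1n addn1.
rewrite basisEfree subvf dimV sizeb !andbT /= free_cons.
rewrite (perm_free (permEl (perm_catC _ _))) /= free_cons.
rewrite (basis_free wb) andbT; apply/andP; split.
  apply: (notin_span _ u0') => // z; rewrite mem_cat inE => /orP[zw|/eqP->//].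
  by rewrite (w_orth z) // !inE eqxx orbT.
apply: (notin_span _ u0) => [|z zw]; last by rewrite (w_orth z) // !inE eqxx.
by rewrite herm_eq0C.
Qed.

End Rational.

Section Isometries.
Variables (K : realType) (V : vectType rat) (B : {symmetric V}).
Variables (k : nat) (u0 u0' : V) (w : k.-tuple V).
Local Notation m := (1 + (k + 1))%N.
Local Notation isom_n := (@isom_n K V B k u0 u0' w).
Local Notation isom_a := (@isom_a K k).
Local Notation siegel_pt := (@siegel_pt K V B k u0 u0' w).

Definition gram : 'M[K]_m := \matrix_(i, j)
  ratr (B (adapted_basis u0 u0' w)`_i (adapted_basis u0 u0' w)`_j).

Lemma u0KE : u0K K k = col_mx 1%:M 0.
Proof.
apply/matrixP => i j; rewrite !mxE ord1; case: splitP => i' ii'; rewrite mxE.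
  by rewrite ord1 -val_eqE /= ii' ord1.
by rewrite -val_eqE /= ii'.
Qed.

Lemma u0'KE : u0'K K k = col_mx 0 (col_mx 0 1%:M).
Proof.
apply/matrixP => i j; rewrite !mxE ord1 -val_eqE /=; case: splitP => i' -> /=.
  by rewrite mxE ord1 addn1.
rewrite mxE; case: splitP => i'' -> /=; rewrite mxE add1n addn1 eqSS.
  by rewrite ltn_eqF // ltnS.
by rewrite ord1 addn0 eqxx.
Qed.

Lemma row_mx3_col_mx3 (R : Type) m1 m2 m3 n1 n2 n3
  (A11 : 'M[R]_(m1, n1)) (A12 : 'M[R]_(m1, n2)) (A13 : 'M[R]_(m1, n3))
  (C : 'M[R]_(m2 + m3, n1)) (A22 : 'M[R]_(m2, n2)) (A23 : 'M[R]_(m2, n3))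
  (A32 : 'M[R]_(m3, n2)) (A33 : 'M[R]_(m3, n3)) :
  row_mx (col_mx A11 C)
    (row_mx (col_mx A12 (col_mx A22 A32)) (col_mx A13 (col_mx A23 A33))) =
  block_mx A11 (row_mx A12 A13) C (block_mx A22 A23 A32 A33).
Proof.
rewrite -[row_mx (col_mx A12 _) _]block_mxEh block_mxEv.
by rewrite -[row_mx (col_mx A22 _) _]block_mxEh -block_mxEh.
Qed.

Lemma isom_aE (t : K) :
  isom_a t = block_mx t%:M 0 0 (block_mx 1%:M 0 0 t^-1%:M).
Proof.
rewrite /Defs.isom_a /inclW u0KE u0'KE !scale_col_mx !scaler0 !scalemx1.
by rewrite row_mx3_col_mx3 row_mx0.
Qed.

Definition isom_n_row (b : 'cV[K]_k) : 'rV[K]_k :=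
  \row_i (2 * formK B u0 u0' w (col i (inclW K k)) (inclW K k *m b)).

Definition isom_n_corner (b : 'cV[K]_k) : K :=
  formK B u0 u0' w (inclW K k *m b) (inclW K k *m b).

Lemma isom_nE (b : 'cV[K]_k) :
  isom_n b = block_mx 1%:M (row_mx (isom_n_row b) (isom_n_corner b)%:M) 0
               (block_mx 1%:M b 0 1%:M).
Proof.
rewrite /Defs.isom_n -/(isom_n_row b) -/(isom_n_corner b).
rewrite u0KE u0'KE /inclW !mul_col_mx !mul0mx !mul1mx.
rewrite !scale_col_mx scaler0 scalemx1 !add_col_mx !addr0 !add0r.
by rewrite row_mx3_col_mx3.
Qed.

Lemma isom_a_unit (t : K) : t != 0 -> isom_a t \in unitmx.
Proof.
move=> t0; rewrite unitmxE isom_aE !det_ublock !det_scalar !expr1 expr1n mul1r.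
by rewrite divff ?unitr1.
Qed.

Lemma isom_n_unit (b : 'cV[K]_k) : isom_n b \in unitmx.
Proof. by rewrite unitmxE isom_nE !det_ublock !det1 !mulr1 unitr1. Qed.

Lemma isom_na_mulK (t : K) (b : 'cV[K]_k) n (X : 'M[K]_(m, n)) : t != 0 ->
  isom_n b *m (isom_a t *m (invmx (isom_a t) *m (invmx (isom_n b) *m X))) = X.
Proof.
by move=> t0; rewrite mulKVmx ?isom_a_unit // mulKVmx ?isom_n_unit.
Qed.

Lemma row_ord_maxE (n : nat) (X : 'M[K]_(m, n)) :
  row ord_max X = (u0'K K k)^T *m X.
Proof. by rewrite /u0'K trmx_delta rowE. Qed.

Lemma last_row_isom_na (t : K) (b : 'cV[K]_k) n (Y : 'M[K]_(m, n)) j :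
  (isom_n b *m (isom_a t *m Y)) ord_max j = t^-1 * Y ord_max j.
Proof.
have -> : (isom_n b *m (isom_a t *m Y)) ord_max j =
    row ord_max (isom_n b *m (isom_a t *m Y)) 0 j by rewrite [RHS]mxE.
have -> : Y ord_max j = row ord_max Y 0 j by rewrite [RHS]mxE.
pose mxs := (mul0mx, mulmx0, mulmx1, mul1mx, @addr0, @add0r, @scaler0).
pose e : 'rV[K]_m := row_mx 0 (row_mx 0 1%:M).
have eE : (u0'K K k)^T = e by rewrite u0'KE !tr_col_mx !trmx0 trmx1.
have en : e *m isom_n b = e by rewrite isom_nE /e !(mul_row_block, mxs).
have ea : e *m isom_a t = t^-1 *: e.
  by rewrite isom_aE /e !(mul_row_block, scale_row_mx, mxs) scalemx1.
by rewrite !row_ord_maxE !mulmxA eE en ea -scalemxAl mxE.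
Qed.

Lemma siegel_pt_inj (t t' : K) (b b' : 'cV[K]_k) : t != 0 ->
  siegel_pt t b = siegel_pt t' b' -> t = t' /\ b = b'.
Proof.
move=> t0.
have ptE (s : K) c : siegel_pt s c =
    col_mx (s%:M + s^-1 *: (isom_n_corner c)%:M)
           (col_mx (s^-1 *: c) (s^-1%:M)).
  rewrite /Defs.siegel_pt -mulmxA isom_aE isom_nE u0KE u0'KE.
  pose mxs := (mul0mx, mulmx0, mulmx1, mul1mx, @addr0, @add0r).
  rewrite add_col_mx !mxs !(mul_block_col, mul_row_col, mxs).
  by rewrite !mul_mx_scalar.
rewrite !ptE => /eq_col_mx[_ /eq_col_mx[bE /matrixP/(_ 0 0)]].
rewrite !mxE !mulr1n => /invr_inj tE; split=> //.
by move: bE; rewrite -tE => /(scalerI (invr_neq0 t0)).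
Qed.

Lemma isom_n_bounded (omega : set 'cV[K]_k) : compact (closure omega) ->
  exists2 M, 0 < M & forall b, omega b -> `|isom_n b| <= M.
Proof.
move=> /compact_bounded[N [_ boundN]].
pose bd p q (F : 'cV[K]_k -> 'M[K]_(p, q)) :=
  exists2 M, 0 <= M & forall b, omega b -> `|F b| <= M.
have bd_id : bd _ _ id.
  exists (`|N| + 1) => [|b ob]; first by rewrite addr_ge0.
  apply: (boundN (`|N| + 1)); last exact: subset_closure.
  by rewrite (le_lt_trans (ler_norm N)) // ltrDl.
have bd_cst p q A : bd p q (fun=> A) by exists `|A|.
have bd_mul p q r F G : bd p q F -> bd q r G -> bd p r (fun b => F b *m G b).
  move=> [M1 M10 h1] [M2 M20 h2]; exists (q%:R * (M1 * M2)) => [|b ob].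
    by rewrite !mulr_ge0.
  rewrite (le_trans (mulmx_norm_le _ _)) // ler_wpM2l //.
  by rewrite ler_pM ?h1 ?h2.
have bd_tr p q F : bd p q F -> bd q p (fun b => (F b)^T).
  move=> [M M0 h]; exists M => // b ob; apply: mx_norm_le => // i j.
  by rewrite mxE (le_trans (mx_entry_le_norm _ _ _)) ?h.
have bd_W : bd _ _ (fun b => inclW K k *m b) by exact: bd_mul.
have [M1 M10 h1] : bd _ _ (fun b => ((inclW K k)^T *m gram) *m (inclW K k *m b)).
  exact: bd_mul.
have [M2 M20 h2] : bd _ _ (fun b => ((inclW K k *m b)^T *m gram) *m (inclW K k *m b)).
  by apply: (bd_mul) => //; apply: (bd_mul) => //; exact: bd_tr.
have [M3 M30 h3] := bd_id.
pose r1 (p : nat) := `|1%:M : 'M[K]_p|.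
exists (r1 1%N + (2 * M1 + M2) + 0 + (r1 k + M3 + 0 + r1 1%N) + 1) => [|b ob].
  have r1_ge0 p : 0 <= r1 p by exact: normr_ge0.
  by rewrite ltr_wpDl // !addr_ge0 // mulr_ge0.
have row_le : `|isom_n_row b| <= 2 * M1.
  apply: mx_norm_le => [|i j]; first by rewrite mulr_ge0.
  rewrite mxE normrM ger0_norm // ler_wpM2l // /formK -/gram tr_col -!row_mul mxE.
  by rewrite (le_trans (mx_entry_le_norm _ _ _)) ?h1.
have corner_le : `|(isom_n_corner b)%:M : 'M[K]_1| <= M2.
  by rewrite -mx11_scalar h2.
rewrite isom_nE; apply: le_trans (block_mx_norm_le _ _ _ _) _.
rewrite -[leLHS]addr0 lerD // normr0 !lerD //.
  by rewrite (le_trans (row_mx_norm_le _ _)) ?lerD.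
apply: le_trans (block_mx_norm_le _ _ _ _) _.
by rewrite normr0 !lerD ?h3.
Qed.

Lemma isom_a_norm_le (t0 t : K) : 0 < t0 -> t0 <= t ->
  `|isom_a t| <= (1 + t0^-1 + t0^-2) * t.
Proof.
move=> t0_gt0 t0t; have t_gt0 := lt_le_trans t0_gt0 t0t.
have le1 : 1 <= t0^-1 * t by rewrite ler_pdivlMl // mulr1.
have leV : t^-1 <= t0^-2 * t.
  rewrite expr2 invfM -mulrA; apply: le_trans (ler_peMr _ le1).
    by rewrite lef_pV2 ?posrE.
  by rewrite invr_ge0 ltW.
rewrite isom_aE; apply: le_trans (block_mx_norm_le _ _ _ _) _.
rewrite !normr0 !addr0 !mulrDl mul1r -addrA lerD //.
  by rewrite (le_trans (scalar_mx_norm_le _ _)) // ger0_norm // ltW.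
apply: le_trans (block_mx_norm_le _ _ _ _) _; rewrite !normr0 !addr0 lerD //.
  by rewrite (le_trans (scalar_mx_norm_le _ _)) // normr1.
by rewrite (le_trans (scalar_mx_norm_le _ _)) // ger0_norm // invr_ge0 ltW.
Qed.

Lemma isom_na_norm_le (omega : set 'cV[K]_k) (t0 : K) n :
  compact (closure omega) -> 0 < t0 ->
  exists2 c, 0 < c & forall t b, t0 < t -> omega b -> forall Y : 'M[K]_(m, n),
    `|isom_n b *m (isom_a t *m Y)| <= c * t * `|Y|.
Proof.
move=> /isom_n_bounded[M M0 hM] t0_gt0.
exists (m%:R * (M * (m%:R * (1 + t0^-1 + t0^-2)))) => [|t b t0t ob Y].
  by rewrite !mulr_gt0 // !addr_gt0 ?invr_gt0 ?exprn_gt0.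
rewrite (le_trans (mulmx_norm_le _ _)) // -!mulrA ler_wpM2l // ler_pM ?hM //.
rewrite (le_trans (mulmx_norm_le _ _)) // ler_wpM2l // mulrA ler_wpM2r //.
by rewrite isom_a_norm_le // ltW.
Qed.

End Isometries.

Section Theta.
Variable K : realType.

Lemma theta_term_norm_le k n (p : ypoly K k n)
    (Q : 'M[K]_((1 + (k + 1))%N, n) -> K[i]%C) :
  quadratic Q -> posdef_re Q -> exists C a : K, [/\ 0 < C, 0 < a & forall Y,
    Normc.normc (yeval p Y * expC (- ((pi : K)%:C%C * Q Y))) <=
      C * expR (- (a * `|Y| ^+ 2))].
Proof.
move=> Qquad Qpos; have [c c0 Qc] := posdef_re_lower_bound Qquad Qpos.
pose a := pi * c / 2; have a0 : 0 < a by rewrite divr_gt0 // mulr_gt0 ?pi_gt0.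
have [C C0 pC] := poly_growth p a0.
exists C, a; split=> // Y; rewrite Normc.normcM normc_expC.
have -> : complex.Re (- (pi%:C%C * Q Y)) = - (pi * complex.Re (Q Y)).
  by case: (Q Y) => x y /=; rewrite mul0r subr0.
apply: (@le_trans _ _ (C * expR (a * `|Y| ^+ 2) * expR (- (pi * (c * `|Y| ^+ 2))))).
  apply: ler_pM => //; rewrite ?expR_ge0 //.
    by case: (yeval p Y) => x y; exact: sqrtr_ge0.
  by rewrite ler_expR lerN2 ler_wpM2l ?pi_ge0.
rewrite -mulrA -expRD ler_wpM2l ?(ltW C0) // ler_expR.
by rewrite (_ : _ - _ = - (a * `|Y| ^+ 2)) // /a; field.
Qed.

(* Coding by naturals reduces sums over Z to geometric series. *)
Definition int_code (z : int) : nat :=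
  match z with Posz s => s.*2 | Negz s => s.*2.+1 end.

Lemma int_code_inj : injective int_code.
Proof.
move=> [s|s] [s'|s'] /=.
- by move=> /double_inj ->.
- by move=> /(congr1 odd); rewrite /= !odd_double.
- by move=> /(congr1 odd); rewrite /= !odd_double.
- by move=> [/double_inj ->].
Qed.

Lemma int_code_le (z : int) : (int_code z)%:R <= 2 * `|z%:~R| :> K.
Proof.
rewrite -intr_norm -abszE pmulrn -natrM ler_nat mul2n.
by case: z => s /=; rewrite ?leqnn // NegzE abszN /= doubleS leqnSn.
Qed.

End Theta.

Theorem lemma5p1 (K : realType) (V : vectType rat) (B : {symmetric V})
    (p0 n : nat) (u0 u0' : V) (w : p0.-1.-tuple V)
    (L : set V) (h : 'I_n -> V)
    (p : ypoly K p0.-1 n)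
    (Q : 'M[K]_((1 + (p0.-1 + 1))%N, n) -> K[i]%C)
    (omega : set 'cV[K]_(p0.-1)) (t0 : K)
    (n_gt0 : (1 <= n)%N) (n_le_p0 : (n <= p0)%N)
    (dimV : \dim {:V} = p0.+1)
    (B_nondegenerate : nondegenerate B)
    (B_signature : has_signature B p0 1)
    (u0_isotropic : B u0 u0 = 0) (u0'_isotropic : B u0' u0' = 0)
    (u0_u0' : B u0 u0' = - (1 / 2))
    (w_basis : basis_of (orthov B <<[:: u0; u0']>>) w)
    (L_lattice : is_lattice L)
    (L_dual : L `<=` dual_lattice B L)
    (L_split : split_lattice L <[u0]> (orthov B <<[:: u0; u0']>>) <[u0']>)
    (h_dual : forall j, dual_lattice B L (h j))
    (p_homogeneous : homogeneous p)
    (p_ideal : in_last_row_ideal p)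
    (Q_quadratic : quadratic Q)
    (Q_posdef : posdef_re Q)
    (omega_open : open omega)
    (omega_relatively_compact : compact (closure omega))
    (t0_gt0 : 0 < t0) :
  exp_decreasing_on B u0 u0' w (siegel_set B u0 u0' w omega t0)
    (theta_star B u0 u0' w L h p Q).
Proof.
have dimVk : \dim {:V} = p0.-1.+2.
  by rewrite dimV prednK // (leq_trans n_gt0).
have basisb : basis_of fullv (adapted_basis u0 u0' w).
  apply: (adapted_basisP (B := B)) => //.
  by rewrite u0_u0' oppr_eq0 mulf_neq0 // invr_eq0.
have [D D_gt0 intD] :=
  coset_common_denominator h (adapted_basis u0 u0' w) L_lattice.
have [c c_gt0 na_le] :=
  isom_na_norm_le B u0 u0' w n omega_relatively_compact t0_gt0.
have [C [a [C_gt0 a_gt0 term_le]]] := theta_term_norm_le p Q_quadratic Q_posdef.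
pose I := ('I_(1 + (p0.-1 + 1)) * 'I_n)%type.
pose z (X : {ffun 'I_n -> V}) (ij : I) : int :=
  numq (D%:R * coord (adapted_basis u0 u0' w) ij.1 (X ij.2)).
have D0 : 0 < D%:R :> K by rewrite ltr0n.
have zE X ij : coset L h X ->
    D%:R * coord (adapted_basis u0 u0' w) ij.1 (X ij.2) = (z X ij)%:~R.
  by move=> coX; rewrite /z numqK // intD.
have realptsE X i j : coset L h X ->
    realpts K u0 u0' w X i j = D%:R^-1 * (z X (i, j))%:~R.
  move=> coX; rewrite mxE -ratr_int -(zE X (i, j)) // rmorphM /= ratr_nat.
  by rewrite mulKf // gt_eqF.
pose code X ij := int_code (z X ij).
have code_inj X X' : coset L h X -> coset L h X' -> code X =1 code X' -> X = X'.
  move=> coX coX' codeXX'; apply/ffunP => j.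
  rewrite (coord_basis basisb (memvf (X j))) (coord_basis basisb (memvf (X' j))).
  apply: eq_bigr => i _; congr (_ *: _).
  apply: (@mulfI _ (D%:R : rat)); first by rewrite pnatr_eq0 -lt0n.
  by rewrite (zE X (i, j)) // (zE X' (i, j)) // (int_code_inj (codeXX' (i, j))).
pose d : K := a / (4 * D%:R ^+ 2 * c * #|{: I}|.+1%:R).
have d_gt0 : 0 < d by rewrite divr_gt0 // !mulr_gt0 // exprn_gt0.
pose r := expR (- d).
have r01 : 0 <= r < 1 by rewrite expR_ge0 /= expR_lt1 oppr_lt0.
pose S := (1 - r)^-1 ^+ #|{: I}|.
have S_gt0 : 0 < S by rewrite exprn_gt0 // invr_gt0 subr_gt0; case/andP: r01.
exists (C * S), (a * t0 / (2 * D%:R ^+ 2)); split.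
- by rewrite mulr_gt0.
- by rewrite divr_gt0 // mulr_gt0 // exprn_gt0.
move=> t b t_gt0 [t' [b' [ob' t0t' /siegel_pt_inj]]].
case=> [|tt' bb']; first by rewrite gt_eqF.
move: ob' t0t'; rewrite -tt' -bb' => ob t0t {t' b' tt' bb'}.
pose E := expR (- (a / 2 * (t / D%:R) ^+ 2)).
have EC : E <= expR (- (a * t0 / (2 * D%:R ^+ 2) * t)).
  rewrite ler_expR lerN2.
  have -> : a / 2 * (t / D%:R) ^+ 2 = a / (2 * D%:R ^+ 2) * t * t.
    by field; rewrite gt_eqF.
  have -> : a * t0 / (2 * D%:R ^+ 2) * t = a / (2 * D%:R ^+ 2) * t * t0.
    by field; rewrite gt_eqF.
  rewrite ler_wpM2l ?(ltW t0t) // mulr_ge0 ?(ltW t_gt0) //.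
  by rewrite divr_ge0 ?(ltW a_gt0) // mulr_ge0 // exprn_ge0.
apply: (@le_trans _ _ (C * E * S)%:E); last first.
  by rewrite lee_fin mulrAC ler_wpM2l // ltW // mulr_gt0.
apply: (esum_geometric_le (g := code)) => // [|X coX].
  by rewrite mulr_ge0 ?expR_ge0 ?ltW.
have -> : \prod_i r ^+ code X i = expR (- (d * \sum_i (code X i)%:R)).
  rewrite mulr_sumr -sumrN expR_sum; apply: eq_bigr => i _.
  by rewrite -expRM_natr mulNr.
set Y := _ *m (_ *m _).
have XE : isom_n B u0 u0' w b *m (isom_a _ t *m Y) = realpts K u0 u0' w X.
  by rewrite isom_na_mulK // gt_eqF.
have [Y0|] := pselect (forall j, Y ord_max j = 0).
  rewrite (last_row_ideal_vanish p_ideal Y0) mul0r Normc.normc0.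
  by rewrite !mulr_ge0 ?expR_ge0 ?ltW.
move=> /existsNP[j /eqP Yj].
apply: (le_trans (term_le Y)).
rewrite -mulrA ler_wpM2l ?(ltW C_gt0) // -expRD ler_expR -opprD lerN2.
have normY : t / D%:R <= `|Y|.
  have Xj : realpts K u0 u0' w X ord_max j = t^-1 * Y ord_max j.
    by rewrite -XE last_row_isom_na.
  have {}Xj : Y ord_max j = t / D%:R * (z X (ord_max, j))%:~R.
    by rewrite -mulrA -realptsE // Xj mulVKf // gt_eqF.
  apply: le_trans (mx_entry_le_norm Y ord_max j).
  have tD : 0 < t / D%:R by rewrite divr_gt0.
  rewrite Xj normrM (gtr0_norm tD) ler_peMr ?(ltW tD) //.
  rewrite -intr_norm ler1z -gtz0_ge1 normr_gt0.
  by apply: contra_neq Yj => z0; rewrite Xj z0 mulr0.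
have normX : \sum_i (code X i)%:R <=
    2 * D%:R * #|{: I}|.+1%:R * `|realpts K u0 u0' w X|.
  apply: (@le_trans _ _ (\sum_(i : I) 2 * D%:R * `|realpts K u0 u0' w X|)).
    apply: ler_sum => -[i j'] _; rewrite (le_trans (int_code_le _ _)) //.
    rewrite -mulrA ler_wpM2l //.
    apply: le_trans (ler_wpM2l (ltW D0) (mx_entry_le_norm _ i j')).
    by rewrite realptsE // normrM gtr0_norm ?invr_gt0 // mulVKf // gt_eqF.
  rewrite sumr_const -[leLHS]mulr_natr mulrAC ler_wpM2r // ler_wpM2l //.
  by rewrite ler_nat.
have normXY : `|realpts K u0 u0' w X| <= c * t * `|Y| by rewrite -XE na_le.
have -> : a * `|Y| ^+ 2 = a / 2 * `|Y| ^+ 2 + a / 2 * `|Y| ^+ 2 by field.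
have a2 : 0 <= a / 2 by rewrite divr_ge0 // ltW.
have tD_ge0 : 0 <= t / D%:R by rewrite divr_ge0 // ltW.
apply: lerD; first by rewrite ler_wpM2l // lerXn2r ?nnegrE.
apply: (@le_trans _ _ (a / 2 * (t / D%:R * `|Y|))); last first.
  by rewrite ler_wpM2l // expr2 ler_wpM2r.
apply: le_trans (ler_wpM2l (ltW d_gt0) normX) _.
have d2_ge0 : 0 <= d * (2 * D%:R * #|{: I}|.+1%:R).
  by rewrite mulr_ge0 // ?(ltW d_gt0) // !mulr_ge0.
rewrite mulrA; apply: le_trans (ler_wpM2l d2_ge0 normXY) _.
rewrite le_eqVlt; apply/orP; left; apply/eqP; rewrite /d; field.
by rewrite pnatr_eq0 /= !gt_eqF.
Qed.
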